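(* For every integer $k\ge 0$ and every graph $G$ of treewidth at most $k$, we have $\pi^*(G)\le 4^k$.
   Context: All graphs are finite and simple. A lazy walk in a graph $G$ is a sequence of vertices $v_1,\dots,v_m$ such that for each $i<m$, either $v_iv_{i+1}\in E(G)$ or $v_i=v_{i+1}$. For a colouring $\phi$ of $V(G)$, a lazy walk $v_1,\dots,v_{2t}$ is $\phi$-repetitive if $\phi(v_i)=\phi(v_{i+t})$ for each $i\in\{1,\dots,t\}$. A colouring $\phi$ is strongly nonrepetitive if for every $\phi$-repetitive lazy walk $v_1,\dots,v_{2t}$ there exists $i\in\{1,\dots,t\}$ with $v_i=v_{i+t}$. $\pi^*(G)$ denotes the minimum number of colours in a strongly nonrepetitive colouring of $G$. *)

(* Defs.v *)
From mathcomp Require Import all_boot.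
Set Implicit Arguments. Unset Strict Implicit. Unset Printing Implicit Defensive.

Definition simple_graph (T : finType) (e : rel T) : Prop :=
  symmetric e /\ irreflexive e.

Definition lazy_rel (T : finType) (e : rel T) : rel T :=
  fun x y => e x y || (x == y).

Definition lazy_walk (T : finType) (e : rel T) (w : seq T) : Prop :=
  match w with
  | [::] => False
  | x :: p => path (lazy_rel e) x p
  end.

Definition strongly_nonrepetitive (T : finType) (C : eqType) (e : rel T)
    (phi : T -> C) : Prop :=
  forall (t : nat) (w : seq T) (x0 : T),
    0 < t -> size w = t + t -> lazy_walk e w ->
    (forall i, i < t -> phi (nth x0 w i) = phi (nth x0 w (i + t))) ->
    exists2 i, i < t & nth x0 w i = nth x0 w (i + t).

Definition pi_star_le (T : finType) (e : rel T) (c : nat) : Prop :=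
  exists phi : T -> 'I_c, strongly_nonrepetitive e phi.

Definition is_tree (I : finType) (tE : rel I) : Prop :=
  [/\ symmetric tE, irreflexive tE, 0 < #|I|,
      (forall x y : I, connect tE x y) &
      (forall c : seq I, uniq c -> 2 < size c -> ~~ cycle tE c)].

Definition tree_decomposition (T : finType) (e : rel T)
    (I : finType) (tE : rel I) (B : I -> {set T}) : Prop :=
  [/\ is_tree tE,
      (forall v : T, exists i : I, v \in B i),
      (forall u v : T, e u v -> exists i : I, (u \in B i) && (v \in B i)) &
      (forall (v : T) (i j : I), v \in B i -> v \in B j ->
         connect (fun a b => [&& tE a b, v \in B a & v \in B b]) i j)].

Definition treewidth_le (T : finType) (e : rel T) (k : nat) : Prop :=
  exists (I : finType) (tE : rel I) (B : I -> {set T}),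
    tree_decomposition e tE B /\ forall i : I, #|B i| <= k.+1.

(* Main.v *)
(** Make any two vertices in a common bag adjacent; the graph becomes chordal, with a
    perfect elimination ordering in which each vertex has at most [k] earlier
    neighbours, all adjacent to each other. Breadth-first layering along this ordering
    puts an earlier neighbour of every non-root vertex in the previous layer, so each
    layer is of the same kind with [k - 1], and an excursion below a layer starts and
    ends at equal or adjacent vertices. Colour a vertex by a colour for its layer number,
    out of 4, together with its colour in its layer, out of [4 ^ (k - 1)]. The layer
    colours make the two halves of a repetitive lazy walk visit the same layers;
    its trace on the topmost layer is then a repetitive lazy walk there. The layer
    colouring is a square-free word on 4 letters without factors [xyx], got by
    inserting a fourth letter in the ternary Thue-Morse word. *)
Require Import Defs.
From mathcomp Require Import all_boot.
From mathcomp Require Import zify.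
Set Implicit Arguments. Unset Strict Implicit. Unset Printing Implicit Defensive.

(** * The Thue-Morse word *)

(** Parity of the binary digit sum of [m]; [n] is fuel, and [m] units are enough because halving
    lowers a positive number. *)
Fixpoint tm_rec n m := if n is n'.+1 then odd m (+) tm_rec n' m./2 else false.
Definition tm m := tm_rec m m.

Lemma tm_rec_fuel n1 n2 m : m <= n1 -> m <= n2 -> tm_rec n1 m = tm_rec n2 m.
Proof.
have tm_rec0 n : tm_rec n 0 = false by elim: n.
elim: n1 n2 m => [|n1 IH] [|n2] [|m] // le1 le2; rewrite ?tm_rec0 //=.
by congr (_ (+) _); apply: IH; lia.
Qed.

Lemma tm_half n : tm n = odd n (+) tm n./2.
Proof.
case: n => // n; rewrite {1}/tm /=; congr (_ (+) _).
by apply: tm_rec_fuel; lia.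
Qed.

Lemma tm_eqS_odd n : tm n = tm n.+1 -> odd n.
Proof.
rewrite [tm n]tm_half [tm n.+1]tm_half; case E: (odd n) => //.
have -> : n.+1./2 = n./2 by lia.
have -> : odd n.+1 by lia.
by case: (tm _).
Qed.

(** Descent on the period. An even period halves along [tm_half]. For an odd one, equal neighbours
    sit only at odd positions, which the shift by [p] would make even; so letters alternate across
    the period and [tm (i + p)] negates [tm i]. *)
Lemma tm_overlap_free p i :
  0 < p -> (forall j, j <= p -> tm (i + j) = tm (i + j + p)) -> False.
Proof.
elim/ltn_ind: p i => p IH i p_gt0 per.
case/boolP: (odd p) => [odd_p|even_p].
  have alt j : j < p -> tm (i + j) <> tm (i + j).+1.
    move=> lt_jp eq_t.
    have o1 := tm_eqS_odd eq_t.
    have eq_t' : tm (i + j + p) = tm (i + j + p).+1.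
      have := per j.+1 lt_jp; rewrite addnS addSn -per; last by lia.
      by rewrite eq_t.
    by have := tm_eqS_odd eq_t'; lia.
  have step j : j < p -> tm (i + j).+1 = ~~ tm (i + j).
    by move/alt; case: (tm _); case: (tm _).
  have iter_step j : j <= p -> tm (i + j) = odd j (+) tm i.
    elim: j => [|j IHj] le_jp; first by rewrite addn0.
    by rewrite addnS step // IHj 1?ltnW //= addNb.
  have := iter_step p (leqnn p); rewrite odd_p /=.
  by have := per 0 (leq0n p); rewrite addn0 => ->; case: (tm _).
apply: (IH p./2 _ (i./2)) => [||j le_j]; try by lia.
have := per j.*2.
rewrite [tm (i + _)]tm_half [tm (i + _ + p)]tm_half.
have -> : odd (i + j.*2 + p) = odd (i + j.*2) by lia.
have -> : (i + j.*2)./2 = i./2 + j by lia.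
have -> : (i + j.*2 + p)./2 = i./2 + j + p./2 by lia.
by move=> /(_ _)/addbI; apply; lia.
Qed.

Definition tern n := if tm n == tm n.+1 then 0 else if tm n then 1 else 2.

Lemma tern_lt3 n : tern n < 3.
Proof. by rewrite /tern; case: ifP => // _; case: ifP. Qed.

(* [tern n] encodes the difference [tm n.+1 - tm n], so sums of [tern] telescope. *)
Lemma tern_square_free p i :
  0 < p -> (forall j, j < p -> tern (i + j) = tern (i + j + p)) -> False.
Proof.
move=> p_gt0 per.
have telescope j : j <= p -> tm (i + j) + tm (i + p) = tm (i + j + p) + tm i.
  elim: j => [|j IHj] le_jp; first by rewrite addn0 addnC.
  have := per j le_jp; have := IHj (ltnW le_jp).
  rewrite addnS addSn /tern.
  by do 2 case: (tm (i + j)) (tm (i + j).+1) => - [];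
     case: (tm (i + j + p)) (tm (i + j + p).+1) => - [] //=; lia.
(* At [j = p] twice one bit equals a sum of two bits, so all three agree. *)
have eq_i : tm i = tm (i + p).
  have := telescope p (leqnn p).
  by case: (tm i); case: (tm (i + p)); case: (tm _).
apply: (@tm_overlap_free p i) => // j /telescope; rewrite -eq_i => /addIn.
by case: (tm _); case: (tm _).
Qed.

(** * Lazy walks on a path *)

Definition near x y := (x <= y.+1) && (y <= x.+1).

(** The separator 3 fills every third position; [n - n %/ 3] counts the other positions below [n].
    The inverse count is [m + m./2]. *)
Definition col n := if n %% 3 == 2 then 3 else tern (n - n %/ 3).

Lemma col_lt4 n : col n < 4.
Proof. by rewrite /col; case: ifP => // _; apply: ltnW; apply: tern_lt3. Qed.

Lemma tern_neqS n : tern n != tern n.+1.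
Proof.
apply/eqP => eq_t; apply: (@tern_square_free 1 n) => // -[|//] _.
by rewrite addn0 addn1.
Qed.

Lemma col_tern m : col (m + m./2) = tern m.
Proof. by rewrite /col ifF; [congr tern|]; lia. Qed.

Lemma not_sep n : n %% 3 <> 2 -> n = (n - n %/ 3) + (n - n %/ 3)./2.
Proof. lia. Qed.

Lemma col_eq_sep x y : col x = col y -> (x %% 3 == 2) = (y %% 3 == 2).
Proof.
rewrite /col; have := tern_lt3 (x - x %/ 3); have := tern_lt3 (y - y %/ 3).
by do 2 case: ifP => //; lia.
Qed.

(** Separators are a multiple of 3 apart. Two other positions at distance 1 or 2 carry consecutive
    letters of [tern], which differ. *)
Lemma col_far x y : x < y -> col x = col y -> x + 3 <= y.
Proof.
move=> lt_xy eq_c; rewrite leqNgt; apply/negP => lt_yx.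
have sep := col_eq_sep eq_c.
have [] : x %% 3 <> 2 /\ y %% 3 <> 2 by lia.
move=> /not_sep Ex /not_sep Ey; move: eq_c; rewrite Ex Ey !col_tern.
have -> : y - y %/ 3 = (x - x %/ 3).+1 by lia.
by apply/eqP; apply: tern_neqS.
Qed.

(** Separators must match separators, so 3 divides [p]; deleting them leaves a square of [tern] with
    period [2 * (p %/ 3)]. *)
Lemma col_square_free p i :
  0 < p -> (forall j, j < p -> col (i + j) = col (i + j + p)) -> False.
Proof.
move=> p_gt0 per.
have p_ge3 : 3 <= p.
  by have := col_far (_ : i < i + p); have := per 0 p_gt0; rewrite addn0; lia.
have p3 : p %% 3 = 0.
  have /per/col_eq_sep : 2 - i %% 3 < p by lia.
  by lia.
apply: (@tern_square_free (2 * (p %/ 3)) (i - i %/ 3)); first by lia.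
move=> j lt_j; set m := i - i %/ 3 + j; rewrite -!col_tern.
have : m + m./2 - i < p by lia.
move=> /per; have -> : i + (m + m./2 - i) = m + m./2 by lia.
by move=> ->; congr col; lia.
Qed.

Lemma col_near_inj x y z : near x y -> near x z -> col y = col z -> y = z.
Proof.
rewrite /near => near_xy near_xz eq_c.
case: (ltngtP y z) => // lt_yz.
- by have := col_far lt_yz eq_c; lia.
- by have := col_far lt_yz (esym eq_c); lia.
Qed.

Section NatWalks.

Variables (t : nat) (a b : nat -> nat).
Hypotheses (a_walk : forall i, i.+1 < t -> near (a i) (a i.+1))
           (b_walk : forall i, i.+1 < t -> near (b i) (b i.+1))
           (col_ab : forall i, i < t -> col (a i) = col (b i)).

(** Recovers the side from which the walk came to [a n], if it has moved at all. *)
Lemma last_change n : n < t ->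
  (forall i, i <= n -> a i = a n) \/
  exists2 i, i <= n & near (a i) (a n) /\ a i <> a n.
Proof.
elim: n => [|n IH] lt_nt; first by left=> i; rewrite leqn0 => /eqP ->.
have near_n := a_walk lt_nt.
have [eq_n|neq_n] := eqVneq (a n) (a n.+1); last first.
  by right; exists n => //; split=> //; apply/eqP.
rewrite -eq_n; case: (IH (ltnW lt_nt)) => [const|[i le_in ai]].
  by left=> i; rewrite leq_eqVlt => /predU1P[->|/const].
by right; exists i => //; apply: leqW.
Qed.

(* Distinct colours on closed neighbourhoods force [b] to be a
   translate or a reflection of [a]. *)
Lemma translate_or_reflect n : n < t ->
  (forall i, i <= n -> b i + a 0 = a i + b 0) \/
  (forall i, i <= n -> b i + a i = a 0 + b 0).
Proof.
elim: n => [|n IH] lt_nt.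
  by left=> i; rewrite leqn0 => /eqP ->; rewrite addnC.
have lt_nt' := ltnW lt_nt.
have extend (P : nat -> Prop) : P n.+1 -> (forall i, i <= n -> P i) ->
    forall i, i <= n.+1 -> P i.
  by move=> Pn Pi i; rewrite leq_eqVlt => /predU1P[->|/Pi].
have near_a := a_walk lt_nt; have near_b := b_walk lt_nt.
have col_n := col_ab lt_nt'; have col_nS := col_ab lt_nt.
have stay : a n.+1 = a n -> b n.+1 = b n.
  move=> eq_a; apply: (@col_near_inj (b n)) => //; first by rewrite /near; lia.
  by rewrite -col_nS eq_a.
have move_ : a n.+1 <> a n -> b n.+1 <> b n.
  move=> neq_a eq_b; apply: neq_a.
  apply: (@col_near_inj (a n)) => //; first by rewrite /near; lia.
  by rewrite col_nS eq_b.
have follow i : i <= n -> near (a i) (a n) -> near (b i) (b n) ->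
    (a i == a n.+1) = (b i == b n.+1).
  move=> le_in near_ai near_bi; have := col_ab (leq_ltn_trans le_in lt_nt').
  move=> col_i; apply/eqP/eqP => [eq_a|eq_b].
    apply: (@col_near_inj (b n)) => //; first by rewrite /near andbC.
    by rewrite -col_i eq_a.
  apply: (@col_near_inj (a n)) => //; first by rewrite /near andbC.
  by rewrite col_i eq_b.
rewrite /near in near_a near_b follow *.
(* If [a] has stood still so far, its next step decides between translation and reflection.
   Otherwise the earlier value next to [a n] tells turning back from going on, and [follow] makes
   [b] do the same. *)
case: (last_change lt_nt') => [const|[i le_in [near_i neq_i]]].
  have constb i : i <= n -> b i = b n.
    case: (IH lt_nt') => H le_in; have := H i le_in; have := H n (leqnn n);
    have := const i le_in; have := const 0 isT; lia.
  have := const 0 isT; have := constb 0 isT => b0 a0.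
  have [same|opp] : b n.+1 + a n = a n.+1 + b n \/ b n.+1 + a n.+1 = a n + b n.
    by case: (a n.+1 =P a n) => [/stay|/move_]; lia.
  - left; apply: extend; first by lia.
    by move=> i le_in; have := const i le_in; have := constb i le_in; lia.
  - right; apply: extend; first by lia.
    by move=> i le_in; have := const i le_in; have := constb i le_in; lia.
have follow_i := follow i le_in near_i; rewrite /near in near_i.
have stay_or_move : (a n.+1 == a n) = (b n.+1 == b n).
  by apply/eqP/eqP => [/stay|eq_b] //; case: (a n.+1 =P a n) => // /move_.
case: (IH lt_nt') => H; [left|right]; apply: extend => //=;
  have Hi := H i le_in; have Hn := H n (leqnn n);
  have := follow_i ltac:(lia); lia.
Qed.

Lemma reach n x : n < t -> a 0 <= x <= a n -> exists2 i, i <= n & a i = x.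
Proof.
elim: n => [|n IH] lt_nt bnd; first by exists 0 => //; lia.
case: (leqP x (a n)) => [le_x|lt_x].
  by case: (IH (ltnW lt_nt)) => [|i le_in <-]; [lia | exists i => //; apply: leqW].
by exists n.+1 => //; have := a_walk lt_nt; rewrite /near; lia.
Qed.

(** Equal colours keep the gap at 3 or more, while one step changes it by at most 2. *)
Lemma lt_stays : a 0 < b 0 -> forall i, i < t -> a i < b i.
Proof.
move=> lt0; elim=> [//|i IH] lt_it.
have := col_far (IH (ltnW lt_it)) (col_ab (ltnW lt_it)).
have := a_walk lt_it; have := b_walk lt_it; rewrite /near.
have := col_ab lt_it; case: (ltngtP (a i.+1) (b i.+1)) => //; lia.
Qed.

(** A reflection would end with [b] below [a], against [lt_stays]. Under a translation, [a] climbs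
    to at least [b 0 - 1], so it meets every value needed for a square in [col] with period
    [b 0 - a 0]. *)
Lemma no_repetition_lt : 0 < t -> near (a t.-1) (b 0) -> a 0 < b 0 -> False.
Proof.
move=> t_gt0 near_ab lt0.
have lt_t : t.-1 < t by lia.
have far0 := col_far lt0 (col_ab t_gt0).
have far_t := col_far (lt_stays lt0 lt_t) (col_ab lt_t).
rewrite /near in near_ab.
case: (translate_or_reflect lt_t) => H; last first.
  by have := H _ (leqnn _); lia.
apply: (@col_square_free (b 0 - a 0) (a 0)); first by lia.
move=> j lt_j; case: (@reach t.-1 (a 0 + j)) => // [|i le_i ai]; first by lia.
have := H i le_i; rewrite -ai col_ab; last by lia.
by move=> E; congr col; lia.
Qed.

End NatWalks.

Lemma near_sym x y : near x y = near y x.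
Proof. exact: andbC. Qed.

(** Unequal starts are refuted by [no_repetition_lt]; from equal starts, [col_near_inj] keeps the
    halves together. *)
Lemma col_repetition_boring_fun t (a b : nat -> nat) : 0 < t ->
  (forall i, i.+1 < t -> near (a i) (a i.+1)) ->
  (forall i, i.+1 < t -> near (b i) (b i.+1)) ->
  near (a t.-1) (b 0) ->
  (forall i, i < t -> col (a i) = col (b i)) ->
  forall i, i < t -> a i = b i.
Proof.
move=> t_gt0 a_walk b_walk near_ab col_ab.
have eq0 : a 0 = b 0.
  case: (ltngtP (a 0) (b 0)) => // lt0; exfalso.
    exact: (@no_repetition_lt t a b).
  (* Reversing the walk exchanges the two halves, hence the sign of [b 0 - a 0]. *)
  have lt_t := lt_stays b_walk a_walk (fun i lt_it => esym (col_ab i lt_it)) lt0.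
  pose ra i := b (t.-1 - i); pose rb i := a (t.-1 - i).
  apply: (@no_repetition_lt t ra rb) => //; rewrite /ra /rb.
  - move=> i lt_it; rewrite near_sym.
    have -> : t.-1 - i = (t.-1 - i.+1).+1 by lia.
    by apply: b_walk; lia.
  - move=> i lt_it; rewrite near_sym.
    have -> : t.-1 - i = (t.-1 - i.+1).+1 by lia.
    by apply: a_walk; lia.
  - by move=> i lt_it; rewrite col_ab //; lia.
  - by rewrite subnn subn0 near_sym.
  - by rewrite subn0; apply: lt_t; lia.
elim=> [//|i IH] lt_it.
apply: (@col_near_inj (a i)); [exact: a_walk| |exact: col_ab].
by rewrite IH ?(ltnW lt_it) //; apply: b_walk.
Qed.

Lemma col_repetition_boring (A B : seq nat) :
  size A = size B -> sorted near (A ++ B) -> map col A = map col B -> A = B.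
Proof.
move=> eq_sz srt eq_col.
case: (posnP (size A)) => [A0|A_gt0].
  by move: A0 eq_sz => /[dup] /size0nil -> /= _ /esym/size0nil.
have step i : i.+1 < size A + size B ->
    near (nth 0 (A ++ B) i) (nth 0 (A ++ B) i.+1).
  by rewrite -size_cat; move/(sortedP 0): srt => walk; apply: walk.
have nthA i : i < size A -> nth 0 (A ++ B) i = nth 0 A i.
  by rewrite nth_cat => ->.
have nthB i : nth 0 (A ++ B) (size A + i) = nth 0 B i.
  by rewrite nth_cat ltnNge leq_addr addKn.
apply: (@eq_from_nth _ 0) => //.
apply: col_repetition_boring_fun => // [i lt_i|i lt_i||i lt_i].
- by rewrite -!nthA; [apply: step|..]; lia.
- by rewrite -!nthB addnS; apply: step; lia.
- rewrite -nthA -?nthB; last by lia.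
  by rewrite addn0 -{2}(prednK A_gt0); apply: step; lia.
- have := congr1 (fun s => nth 0 s i) eq_col.
  by rewrite !(nth_map 0) -?eq_sz.
Qed.

(** * Layerings of chordal graphs *)

Section EliminationOrder.

Variables (T : finType).
Implicit Types (e : rel T) (rk lay : T -> nat).

Definition earlier e rk v : {set T} := [set u | e u v & rk u < rk v].

Definition perfect_elimination e rk k :=
  [/\ symmetric e, irreflexive e, injective rk,
      forall v x y, x \in earlier e rk v -> y \in earlier e rk v -> x != y -> e x y
    & forall v, #|earlier e rk v| <= k].

(** [lay v] is one more than the least layer among the earlier neighbours of [v], if there are
    any. *)
Definition layering e rk lay := forall v,
  (forall u, u \in earlier e rk v -> lay v <= (lay u).+1) /\
  (forall u, u \in earlier e rk v ->
     exists2 w, w \in earlier e rk v & lay v = (lay w).+1).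

Definition same_layer e lay : rel T := fun u v => e u v && (lay u == lay v).

Fixpoint bfs_layer e rk n v :=
  if n is n'.+1 then
    if [pick u in earlier e rk v] is Some u0 then
      (bfs_layer e rk n' [arg min_(u < u0 in earlier e rk v) bfs_layer e rk n' u]).+1
    else 0
  else 0.

Lemma bfs_layer_fuel e rk n m v :
  rk v < n -> rk v < m -> bfs_layer e rk n v = bfs_layer e rk m v.
Proof.
elim: n m v => [|n IH] [|m] v //= lt_n lt_m.
case: pickP => [u0 u0v|//]; congr _.+1.
have eq_bfs u : u \in earlier e rk v -> bfs_layer e rk n u = bfs_layer e rk m u.
  by rewrite inE => /andP[_ lt_uv]; apply: IH; apply: leq_trans lt_uv _.
case: arg_minnP => // x xv minx; case: arg_minnP => // y yv miny.
apply/eqP; rewrite eqn_leq; have := minx y yv; have := miny x xv.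
by rewrite !eq_bfs // => -> ->.
Qed.

Lemma layering_exists e rk : exists lay, layering e rk lay.
Proof.
exists (fun v => bfs_layer e rk (rk v).+1 v) => v.
have fuel u : u \in earlier e rk v ->
    bfs_layer e rk (rk u).+1 u = bfs_layer e rk (rk v) u.
  by rewrite inE => /andP[_ lt_uv]; apply: bfs_layer_fuel.
rewrite [bfs_layer e rk (rk v).+1 v]/=; case: pickP => [u0 u0v|none]; last first.
  by split=> u uv; have := none u; rewrite uv.
case: arg_minnP => // w wv minw; split=> u uv; last first.
  by exists w => //; rewrite fuel.
by rewrite fuel // ltnS minw.
Qed.

Section Layers.

Variables (e : rel T) (rk lay : T -> nat) (k : nat).
Hypotheses (peo : perfect_elimination e rk k) (layP : layering e rk lay).

Lemma earlier_or x y : e x y -> x \in earlier e rk y \/ y \in earlier e rk x.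
Proof.
case: peo => e_sym e_irr rk_inj _ _ exy; rewrite !inE [e y x]e_sym exy /=.
case: (ltngtP (rk x) (rk y)) => [||/rk_inj eq_xy]; [by left|by right|].
by move: exy; rewrite eq_xy e_irr.
Qed.

(** Let [w] be an earlier neighbour of [v] in the previous layer. Then [u] and [w] are equal or
    adjacent, and induction on the later of the two gives [lay u <= lay w + 1]. *)
Lemma layer_mono u v : u \in earlier e rk v -> lay u <= lay v <= (lay u).+1.
Proof.
case: peo => _ _ _ clique _.
elim/ltn_ind: {v}(rk v) {-2}v (erefl (rk v)) u => n IH v def_n u uv.
rewrite (layP v).1 // andbT; have [w wv ->] := (layP v).2 u uv.
have [->//|neq_uw] := eqVneq u w.
have lt_n x : x \in earlier e rk v -> rk x < n by rewrite inE def_n => /andP[].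
case: (earlier_or (clique _ _ _ uv wv neq_uw)) => [uw|wu].
  by have := IH _ (lt_n w wv) w erefl u uw; lia.
by have := IH _ (lt_n u uv) u erefl w wu; lia.
Qed.

Lemma layer_near x y : lazy_rel e x y -> near (lay x) (lay y).
Proof.
rewrite /near => /orP[/earlier_or[/layer_mono|/layer_mono]|/eqP->]; lia.
Qed.

Lemma lazy_earlier p q M : lazy_rel e p M -> lazy_rel e q M ->
  rk p <= rk M -> rk q <= rk M -> lazy_rel e p q.
Proof.
case: peo => e_sym e_irr rk_inj clique _.
rewrite /lazy_rel => /orP[epM|/eqP->]; last by rewrite [e q M]e_sym eq_sym.
case/orP=> [eqM|/eqP->]; last by rewrite epM.
move=> le_p le_q; have [//|neq_pq] := eqVneq p q; rewrite ?orbT // orbF.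
have in_M x : e x M -> rk x <= rk M -> x \in earlier e rk M.
  move=> exM; rewrite inE exM /= leq_eqVlt => /predU1P[/rk_inj eq_x|//].
  by rewrite eq_x e_irr in exM.
by apply: (clique M); rewrite // in_M.
Qed.

Lemma lazy_sym x y : lazy_rel e x y = lazy_rel e y x.
Proof. by case: peo => e_sym _ _ _ _; rewrite /lazy_rel e_sym eq_sym. Qed.

Lemma deeper_neighbour_later x M : lazy_rel e x M -> lay x < lay M -> rk x <= rk M.
Proof.
move=> exM lt_lay; rewrite leqNgt; apply/negP => lt_rk.
case/orP: exM => [/earlier_or[]|/eqP eq_x]; last by rewrite eq_x ltnn in lt_lay.
  by rewrite inE [rk x < _]ltnNge (ltnW lt_rk) andbF.
by move/layer_mono; lia.
Qed.

(* The latest vertex of the walk is an interior one; its two neighbours on the walk,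
   being both earlier, are equal or adjacent, so it can be skipped. *)
Lemma shadow_complete x y s :
  path (lazy_rel e) x (rcons s y) -> lay x = lay y ->
  all (fun z => lay x < lay z) s -> lazy_rel e x y.
Proof.
elim: {s}(size s) {-2}s (erefl (size s)) => [|n IH] s.
  by move/size0nil=> -> /=; rewrite andbT.
move=> sz_s walk eq_lay deep.
have [M0 M0s] : exists M0, M0 \in s.
  by case: s sz_s {walk deep} => // a s _; exists a; apply: mem_head.
case: (@arg_maxnP _ M0 (mem s) rk M0s) => M /= Ms maxM.
have deepM := allP deep M Ms.
case/splitPr: Ms sz_s walk deep maxM => s1 s2.
rewrite size_cat /= addnS => -[sz] + deep maxM.
rewrite rcons_cat cat_path /= => /and3P[walk1 ePM walk2].
move: deep; rewrite all_cat /= => /and3P[deep1 _ deep2].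
have le_p : rk (last x s1) <= rk M.
  have [eqx|/maxM//] : last x s1 = x \/ last x s1 \in s1 ++ M :: s2.
  - by case/lastP: s1 {walk1 ePM deep1 sz maxM} => [|s1 z]; [left|right];
       rewrite // last_rcons mem_cat mem_rcons mem_head.
  by rewrite eqx in ePM *; apply: deeper_neighbour_later.
apply: (IH (s1 ++ s2)); rewrite ?size_cat ?all_cat ?deep1 ?rcons_cat ?cat_path ?walk1 //=.
case: s2 walk2 deep2 maxM {sz} => [|z s2] /= /andP[eMz walk2] deep2 maxM; rewrite ?walk2 andbT.
  apply: (lazy_earlier ePM) => //; first by rewrite lazy_sym.
  by apply: deeper_neighbour_later; rewrite 1?lazy_sym // -eq_lay.
apply: (lazy_earlier ePM) => //; first by rewrite lazy_sym.
by apply: maxM; rewrite mem_cat !inE eqxx !orbT.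
Qed.

(** A vertex with an earlier neighbour has one in the previous layer, which is lost on restricting
    to a layer. *)
Lemma same_layer_elimination : perfect_elimination (same_layer e lay) rk k.-1.
Proof.
case: peo => e_sym e_irr rk_inj clique card_le.
have sub v u : u \in earlier (same_layer e lay) rk v ->
    u \in earlier e rk v /\ lay u = lay v.
  by rewrite !inE => /andP[/andP[-> /eqP->] ->].
split=> //.
- by move=> x y; rewrite /same_layer e_sym eq_sym.
- by move=> x; rewrite /same_layer e_irr.
- move=> v x y /sub[xv lx] /sub[yv ly] neq_xy.
  by rewrite /same_layer lx ly eqxx andbT; apply: (clique v).
move=> v; have [->|[u]] := set_0Vmem (earlier (same_layer e lay) rk v).
  by rewrite cards0.
move=> /sub[/(layP v).2 [w wv lay_v] _].
suff : #|earlier (same_layer e lay) rk v| < #|earlier e rk v|.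
  by have := card_le v; lia.
apply: proper_card; apply/properP; split; first by apply/subsetP => z /sub[].
by exists w => //; apply/negP => /sub[_]; rewrite lay_v; lia.
Qed.

(** Between consecutive visits to layer [d] the walk stays strictly deeper, so [shadow_complete]
    joins the two visits. *)
Lemma sorted_filter_layer d w : all (fun z => d <= lay z) w ->
  sorted (lazy_rel e) w ->
  sorted (lazy_rel (same_layer e lay)) [seq z <- w | lay z == d].
Proof.
(* [x] is the latest visit to layer [d], [s] the excursion since then, [p] the rest of the walk. *)
have from p : forall x s, lay x = d -> all (fun z => d < lay z) s ->
    all (fun z => d <= lay z) p -> path (lazy_rel e) x (s ++ p) ->
    path (lazy_rel (same_layer e lay)) x [seq z <- p | lay z == d].
  elim: p => [//|y p IH] x s lx deep /= /andP[le_y le_p] walk.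
  case: eqP => [ly|neq_y]; last first.
    apply: (IH x (rcons s y)) => //; last by rewrite cat_rcons.
    by rewrite all_rcons deep andbT; lia.
  move: walk; rewrite -cat_rcons cat_path last_rcons => /andP[walk_y walk_p] /=.
  rewrite (IH y [::]) // andbT.
  have : lazy_rel e x y.
    by apply: (shadow_complete walk_y); rewrite lx.
  by rewrite /lazy_rel /same_layer lx ly eqxx andbT.
elim: w => [//|x w IH] /= /andP[le_x le_w] walk.
case: eqP => [lx|_]; first exact: (from w x [::]).
by apply: IH => //; apply: path_sorted walk.
Qed.

End Layers.

(** * Product colouring along the layers *)

Lemma map_filter_eq (S : Type) (f : T -> S) (P : pred T) A B :
  map P A = map P B -> map f A = map f B ->
  map f (filter P A) = map f (filter P B).
Proof.
elim: A B => [|a A IH] [|b B] //= [eqP_ab eqP_AB] [eqf_ab eqf_AB].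
by rewrite -eqP_ab; case: (P a); rewrite /= ?eqf_ab (IH B).
Qed.

Lemma filter_zip_fst (P : pred T) A B : map P A = map P B ->
  zip (filter P A) (filter P B) = [seq x <- zip A B | P x.1].
Proof.
elim: A B => [|a A IH] [|b B] //= [eqP_ab /IH eq_AB].
by rewrite -eqP_ab; case: (P a); rewrite /= eq_AB.
Qed.

(** The halves are lists, so that passing to the trace on a layer is a [filter]; a pair [(x, x)] in
    the zip is a position where they agree. *)
Lemma elimination_coloring k e rk : perfect_elimination e rk k ->
  exists2 phi : T -> nat, forall v, phi v < 4 ^ k &
    forall A B, size A = size B -> A <> [::] ->
      sorted (lazy_rel e) (A ++ B) -> map phi A = map phi B ->
      exists x, (x, x) \in zip A B.
Proof.
elim: k e => [|k IH] e peo.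
  exists (fun=> 0) => // -[|a A] [|b B] //= _ _ walk _; exists a.
  have no_edge x y : e x y = false.
    apply/negP => /(earlier_or peo)[]; case: peo => _ _ _ _ /(_ _);
    by move=> card0 xy; have := card0 y; have := card0 x;
       rewrite !leqn0 !cards_eq0 => /eqP Ex /eqP Ey;
       rewrite ?Ex ?Ey inE in xy.
  have const p x : path (lazy_rel e) x p -> {subset p <= [:: x]}.
    elim: p x => [//|y p IHp] x /= /andP[]; rewrite {1}/lazy_rel no_edge /=.
    move=> /eqP <- /IHp sub z; rewrite inE => /predU1P[->|/sub//].
    exact: mem_head.
  have := const _ _ walk b; rewrite mem_cat mem_head orbT inE.
  by move=> /(_ isT) /eqP ->; apply: mem_head.
have [lay layP] := layering_exists e rk.
have peo' := same_layer_elimination peo layP.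
have [phi' phi'_lt phi'P] := IH _ peo'.
exists (fun v => 4 * phi' v + col (lay v)) => [v|A B eq_sz A_n0 walk eq_col].
  by have := phi'_lt v; have := col_lt4 (lay v); rewrite expnS; lia.
have decode (f : nat -> nat) (g : T -> nat) :
    (forall v, f (4 * phi' v + col (lay v)) = g v) -> map g A = map g B.
  move=> fE; have := congr1 (map f) eq_col; rewrite -!map_comp.
  by rewrite !(eq_map (_ : _ =1 g)).
have eq_lay : map lay A = map lay B.
  apply: col_repetition_boring; rewrite ?size_map //.
    by rewrite -map_cat sorted_map; apply: sub_sorted walk => x y /(layer_near peo layP).
  rewrite -!map_comp; apply: (@decode (modn^~ 4)) => v /=.
  by have := col_lt4 (lay v); lia.
have eq_phi' : map phi' A = map phi' B.
  by apply: (@decode (divn^~ 4)) => v; have := col_lt4 (lay v); lia.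
have [x0 x0A] : exists x0, x0 \in A.
  by case: A A_n0 {walk eq_sz eq_col decode eq_lay eq_phi'} => // a A _; exists a; apply: mem_head.
have x0w : x0 \in A ++ B by rewrite mem_cat x0A.
case: (@arg_minnP _ x0 (mem (A ++ B)) lay x0w) => m /= mw minm.
pose P := fun z => lay z == lay m.
(* Both halves meet the topmost layer at the same positions, so an agreement between the traces is
   one between [A] and [B]. *)
have eq_P : map P A = map P B.
  have := congr1 (map (eq_op^~ (lay m))) eq_lay.
  by rewrite -!map_comp.
have filter_phi' := map_filter_eq eq_P eq_phi'.
have eq_sz' : size (filter P A) = size (filter P B).
  by have := congr1 size filter_phi'; rewrite !size_map.
have [| |x] := phi'P (filter P A) (filter P B) eq_sz' _ _ filter_phi'.
- move=> A0; move: eq_sz'; rewrite A0 => /esym/size0nil B0.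
  have : m \in filter P (A ++ B) by rewrite mem_filter /P eqxx.
  by rewrite filter_cat A0 B0.
- rewrite -filter_cat; apply: (sorted_filter_layer peo layP) => //.
  by apply/allP => z /minm.
by rewrite filter_zip_fst // mem_filter => /andP[_]; exists x.
Qed.

End EliminationOrder.

(** * From tree decompositions to elimination orderings *)

Section RootedTree.

Variables (I : finType) (tE : rel I).

Definition restrict (S : {set I}) : rel I :=
  fun a b => [&& tE a b, a \in S & b \in S].

(** [d] is an order of insertion, not a depth: injectivity makes the node minimising it unique. *)
Definition rooted_on (S : {set I}) (par : I -> I) (d : I -> nat) :=
  {in S &, injective d} /\
  {in S &, forall a b, tE a b -> (b = par a /\ d b < d a) \/ (a = par b /\ d a < d b)}.

Hypothesis treeP : is_tree tE.

(** Otherwise a path inside [S] from [a] to [a'] closes through [b] into a cycle. *)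
Lemma unique_attachment (S : {set I}) a a' b :
  {in S &, forall x y, connect (restrict S) x y} ->
  a \in S -> a' \in S -> b \notin S -> tE a b -> tE a' b -> a = a'.
Proof.
move=> conn aS a'S bS ab a'b; case: treeP => t_sym t_irr _ _ acyclic.
have /connectP[p0 walk0 last0] := conn a a' aS a'S.
case: (shortenP walk0) last0 => p walk uniq_p _ last_p.
case: p walk uniq_p last_p => [|x p] walk uniq_p last_p; first by rewrite last_p.
have inS : {subset a :: x :: p <= S}.
  have sub q z : z \in S -> path (restrict S) z q -> {subset z :: q <= S}.
    elim: q z => [|y q IH] z zS /=; first by move=> _ u; rewrite inE => /eqP->.
    by case/andP=> /and3P[_ _ yS] /(IH y yS) sub u; rewrite inE => /predU1P[->|/sub].
  exact: sub.
have := acyclic (b :: a :: x :: p); rewrite cons_uniq uniq_p andbT.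
have -> : b \notin a :: x :: p by apply/negP => /inS; apply/negP.
move=> /(_ isT isT)/negP[]; rewrite /= rcons_path /= in last_p *.
rewrite -last_p a'b t_sym ab /= andbT.
by apply: sub_path walk => u v /and3P[].
Qed.

(** Grow a subtree node by node: the new node becomes a child of its only neighbour in [S] and gets
    the largest number. *)
Lemma rooted_exists_card n : 0 < n <= #|I| ->
  exists (S : {set I}) par d,
    [/\ #|S| = n, {in S &, forall x y, connect (restrict S) x y},
        {in S, forall x, d x < n} & rooted_on S par d].
Proof.
case: treeP => t_sym t_irr I_gt0 t_conn _.
elim: n => // -[|n] IH le_n.
  have /card_gt0P[r _] := I_gt0.
  exists [set r], id, (fun=> 0); split; rewrite ?cards1 //.
  - by move=> x y /set1P-> /set1P->.
  - split=> x y /set1P-> /set1P-> //; by rewrite t_irr.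
case: IH => [|S [par [d [card_S conn lt_d [d_inj d_par]]]]]; first by lia.
have [a [b [aS bS ab]]] : exists a b, [/\ a \in S, b \notin S & tE a b].
  have /card_gt0P[r rS] : 0 < #|S| by rewrite card_S.
  have /subsetPn[z _ zS] : ~~ (setT \subset S).
    by apply/negP => /subset_leq_card; rewrite cardsT card_S; lia.
  have /connectP[p walk last_p] := t_conn r z.
  elim: p r rS walk last_p => [|y p IHp] r rS /=; first by move=> _ z_r; rewrite z_r rS in zS.
  case/andP=> ry walk last_p; have [yS|yS] := boolP (y \in S); last by exists r, y.
  exact: (IHp y).
exists (b |: S), [eta par with b |-> a], [eta d with b |-> n.+1].
have ne_b x : x \in S -> (x == b) = false.
  by move=> xS; apply/eqP => eq_x; rewrite -eq_x xS in bS.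
have mono x y : connect (restrict S) x y -> connect (restrict (b |: S)) x y.
  apply: connect_sub => {x y} x y /and3P[xy xS yS].
  by apply: connect1; rewrite /restrict xy !inE xS yS !orbT.
have connb x : x \in S -> connect (restrict (b |: S)) x b.
  move=> xS; apply: connect_trans (mono _ _ (conn x a xS aS)) _.
  by apply: connect1; rewrite /restrict ab !inE aS eqxx orbT.
have connb' x : x \in S -> connect (restrict (b |: S)) b x.
  move=> xS; apply: connect_trans (mono _ _ (conn a x aS xS)).
  by apply: connect1; rewrite /restrict t_sym ab !inE aS eqxx orbT.
split.
- by rewrite cardsU1 bS card_S.
- move=> x y /setU1P[->|xS] /setU1P[->|yS] //; [exact: connb'|exact: connb|].
  by apply: mono; apply: conn.
- by move=> x /setU1P[->|xS] /=; rewrite ?eqxx // ne_b // ltnS ltnW // lt_d.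
have lt_n x : x \in S -> d x < n.+1 by move/lt_d.
split=> x y /setU1P[->|xS] /setU1P[->|yS] /=; rewrite ?eqxx ?ne_b //.
- by move=> eq_d; have := lt_n y yS; rewrite -eq_d ltnn.
- by move=> eq_d; have := lt_n x xS; rewrite eq_d ltnn.
- exact: d_inj.
- by rewrite t_irr.
- move=> by_; left; split; last exact: lt_n.
  by apply: (unique_attachment conn yS aS bS) => //; rewrite t_sym.
- move=> xb; right; split; last exact: lt_n.
  exact: (unique_attachment conn xS aS bS).
- exact: d_par.
Qed.

Lemma rooted_exists : exists par d, rooted_on setT par d.
Proof.
have [] := @rooted_exists_card #|I|; first by case: treeP => _ _ ->; rewrite leqnn.
move=> S [par [d [card_S _ _ rootS]]]; exists par, d.
by have /eqP <- : S == setT by rewrite eqEcard subsetT cardsT card_S /=.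
Qed.

(* A walk from [x] can only leave the descendants of [x] through the edge from [x] to
   its parent. *)
Lemma parent_in_connected (S : {set I}) par d x s : rooted_on setT par d ->
  connect (restrict S) x s -> d s < d x -> par x \in S /\ d (par x) < d x.
Proof.
move=> [_ d_par] /connectP[p walk ->] {s}.
pose up a b := (b == par a) && (d b < d a).
have up_le a b : connect up a b -> d b <= d a.
  case/connectP=> q; elim: q a => [|c q IH] a /=; first by move=> _ ->.
  by case/andP=> /andP[_ lt_ca] walk_q /(IH _ walk_q); lia.
(* Invariant along the walk: the current node is a descendant of [x]. *)
have : connect up x x by apply: connect0.
elim: p {1 2 4}x walk => [|b p IH] a /=; first by move=> _ /up_le; lia.
case/andP=> /and3P[ab aS bS] walk ax lt_d.
case: (d_par a b (in_setT _) (in_setT _) ab) => [[eq_b lt_b]|[eq_a lt_a]]; last first.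
  apply: (IH b) => //; apply: connect_trans ax; apply: connect1.
  by rewrite /up eq_a eqxx -eq_a.
case/connectP: ax => -[|c q] /=; first by move=> _ ->; rewrite -eq_b.
case/andP=> /andP[/eqP eq_c _] walk_q last_q.
by apply: (IH b) => //; apply/connectP; exists q; rewrite // eq_b -eq_c.
Qed.

End RootedTree.

(** * Elimination order from a tree decomposition *)

Section TreeDecomposition.

Variables (T I : finType) (e : rel T) (tE : rel I) (B : I -> {set T}).
Hypothesis tdP : tree_decomposition e tE B.

Definition share_bag : rel T :=
  fun u v => (u != v) && [exists i, (u \in B i) && (v \in B i)].

(** Order vertices by their topmost bags. All earlier neighbours of [v] then lie in [B (top v)],
    which makes them a clique of at most [k] vertices. *)
Lemma share_bag_elimination k : (forall i, #|B i| <= k.+1) ->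
  exists rk, perfect_elimination share_bag rk k.
Proof.
move=> card_B; case: tdP => tree cover _ sub_conn.
have [par [d root]] := rooted_exists tree.
pose S v := [set i | v \in B i].
have connS v i j : v \in B i -> v \in B j -> connect (restrict tE (S v)) i j.
  move=> vi vj; have := sub_conn v i j vi vj.
  by rewrite (@eq_connect _ _ (restrict tE (S v))) // => a b; rewrite /restrict !inE.
have /fin_all_exists2[top topB topmin] v :
    exists2 i, v \in B i & forall j, v \in B j -> d i <= d j.
  have [i0 vi0] := cover v.
  by case: (@arg_minnP _ i0 (fun i => v \in B i) d vi0) => i vi mini; exists i.
(* Lexicographic order in one number: [d (top v)] first, ties broken by [enum_rank]. *)
pose rk v := d (top v) * #|T| + enum_rank v.
have rk_lt u v : d (top u) < d (top v) -> rk u < rk v.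
  move=> lt_d; apply: leq_trans (leq_addr _ _).
  apply: leq_trans (leq_mul lt_d (leqnn #|T|)).
  by rewrite /rk mulSn addnC -addSn leq_add2r; apply: ltn_ord.
have d_le u v : rk u < rk v -> d (top u) <= d (top v).
  by apply: contraTT; rewrite -ltnNge -leqNgt => /rk_lt/ltnW.
(* Climb from a common bag: while it is below [top v], both vertices also lie in the parent bag. *)
have meet_top u v i : d (top u) <= d (top v) -> u \in B i -> v \in B i ->
    u \in B (top v).
  move=> le_d; elim/ltn_ind: {i}(d i) {-2}i (erefl (d i)) => n IH i def_n ui vi.
  have := topmin v i vi; rewrite leq_eqVlt => /predU1P[eq_d|lt_d].
    by rewrite (root.1 _ _ (in_setT _) (in_setT _) eq_d).
  have [pv lt_p] := parent_in_connected root (connS v _ _ vi (topB v)) lt_d.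
  have lt_du := leq_ltn_trans le_d lt_d.
  have [pu _] := parent_in_connected root (connS u _ _ ui (topB u)) lt_du.
  by rewrite inE in pu; rewrite inE in pv; apply: (IH (d (par i))); rewrite -?def_n.
have earlier_top v u : u \in earlier share_bag rk v -> u \in B (top v) :\ v.
  rewrite !inE => /andP[/andP[-> /existsP[i /andP[ui vi]]] /d_le le_d] /=.
  exact: meet_top ui vi.
exists rk; split.
- by move=> u v; rewrite /share_bag eq_sym; congr andb; apply: eq_existsb => i; apply: andbC.
- by move=> u; rewrite /share_bag eqxx.
- move=> u v eq_rk; apply/enum_rank_inj/ord_inj.
  case: (ltngtP (d (top u)) (d (top v))) => [/rk_lt|/rk_lt|eq_d]; rewrite ?eq_rk ?ltnn //.
  by move: eq_rk; rewrite /rk eq_d => /addnI.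
- move=> v x y /earlier_top/setD1P[_ xv] /earlier_top/setD1P[_ yv] neq_xy.
  by rewrite /share_bag neq_xy; apply/existsP; exists (top v); rewrite xv.
move=> v; apply: leq_trans (_ : #|B (top v) :\ v| <= k).
  by apply: subset_leq_card; apply/subsetP => u /earlier_top.
by have := cardsD1 v (B (top v)); rewrite topB; have := card_B (top v); lia.
Qed.

End TreeDecomposition.

Theorem mainTheorem5 (k : nat) (T : finType) (e : rel T) :
  simple_graph e -> treewidth_le e k -> pi_star_le e (4 ^ k).
Proof.
move=> [_ e_irr] [I [tE [B [td card_B]]]].
have [rk peo] := share_bag_elimination td card_B.
have [phi phi_lt phiP] := elimination_coloring peo.
exists (fun v => Ordinal (phi_lt v)) => t w x0 t_gt0 sz_w walk rep.
have szA : size (take t w) = t by rewrite size_take sz_w; case: ifP; lia.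
have szB : size (drop t w) = t by rewrite size_drop sz_w addnK.
have [||||x] := phiP (take t w) (drop t w).
- by rewrite szA szB.
- by move=> A0; rewrite A0 in szA; rewrite -szA in t_gt0.
(* Every edge lies in a bag, so the walk is a lazy walk for [share_bag] too. *)
- rewrite cat_take_drop; case: w walk {rep sz_w szA szB} => //= a p.
  apply: sub_path => x y; rewrite /lazy_rel => /orP[exy|->]; last by rewrite orbT.
  have [_ _ edge _] := td; rewrite /share_bag; have [i uv] := edge _ _ exy.
  have -> : x != y by apply/eqP => eq_xy; rewrite eq_xy e_irr in exy.
  by apply/orP; left; apply/existsP; exists i.
- apply: (@eq_from_nth _ 0); rewrite !size_map szA ?szB // => i lt_i.
  rewrite !(nth_map x0) ?szA ?szB // nth_take // nth_drop addnC.
  by have /(congr1 (@nat_of_ord _)) /= := rep i lt_i.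
move=> /(nthP (x0, x0))[i]; rewrite size_zip szA szB minnn => lt_i.
rewrite nth_zip ?szA ?szB // nth_take // nth_drop addnC => -[eq_i eq_it].
by exists i; rewrite // eq_i eq_it.
Qed.
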